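(* Let $A,B$ be finite-dimensional Hilbert spaces. For any bipartite quantum state $\rho_{AB}$ and any error tolerance $\varepsilon\in(0,1)$, the one-shot distillable entanglement under PPT operations is given by $$E_{\mathrm{D},\mathrm{PPT}}^{(1),\varepsilon}(\rho_{AB})=\log\max\Big\{\lfloor 1/\eta\rfloor \;:\; 0\le M_{AB}\le \mathbb 1_{AB},\ \operatorname{Tr}\rho_{AB}M_{AB}\ge 1-\varepsilon,\ -\eta\mathbb 1_{AB}\le M_{AB}^{T_B}\le\eta\mathbb 1_{AB}\Big\},$$ where the maximum is over real numbers $\eta$ and Hermitian operators $M_{AB}$ on $A\otimes B$ satisfying the stated constraints.
   Context: All Hilbert spaces are finite-dimensional; $\log$ is base $2$. A quantum state is a positive semidefinite operator of unit trace. $T_B$ denotes partial transpose on $B$ with respect to a fixed orthonormal product basis; $\mathbb 1$ is the identity. PPT operations: a completely positive trace-preserving linear map $\Pi_{AB\to A'B'}$ is a PPT operation if its Choi–Jamiołkowski matrix $J_\Pi=\sum_{i,j,m,k}|i_Aj_B\rangle\langle m_Ak_B|\otimes\Pi(|i_Aj_B\rangle\langle m_Ak_B|)$ satisfies $J_\Pi^{T_{BB'}}\ge 0$. For $k\in\mathbb N$, $k\ge1$, let $\Psi_k=\frac1k\sum_{i,j=0}^{k-1}|ii\rangle\langle jj|$ be the $k$-dimensional maximally entangled state on $A'\otimes B'$ with $\dim A'=\dim B'=k$. The fidelity of distillation is $F_{\mathrm{PPT}}(\rho_{AB},k)=\max_{\Pi\in \mathrm{PPT}}\operatorname{Tr}\,\Pi_{AB\to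 A'B'}(\rho_{AB})\Psi_k$, and $$E_{\mathrm{D},\mathrm{PPT}}^{(1),\varepsilon}(\rho_{AB})=\log\max\{k\in\mathbb N: F_{\mathrm{PPT}}(\rho_{AB},k)\ge 1-\varepsilon\}.$$ *)

(* Defs.v *)
From HB Require Import structures.
From mathcomp Require Import all_boot all_order all_algebra.
From mathcomp Require Import sesquilinear spectral.
From mathcomp.real_closed Require Import complex mxtens.
From mathcomp Require Import all_classical all_reals all_analysis.

Set Implicit Arguments.
Unset Strict Implicit.
Unset Printing Implicit Defensive.

Import Order.TTheory GRing.Theory Num.Theory.

Local Open Scope classical_set_scope.
Local Open Scope ring_scope.
Local Open Scope sesquilinear_scope.
Local Open Scope complex_scope.

(* Operators on C^d are matrices over R[i] in a fixed orthonormal basis.  The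
   product basis of C^a (x) C^b is indexed by 'I_(a * b) as in mxtens: the
   vector |i>|j> has index mxtens_index (i, j), so that *t is the tensor
   product. *)

Section Maximum.
Context {R : realType}.
Implicit Type S : set R.

Definition has_max S := (S `&` ubound S) !=set0.

(* The greatest element of S when has_max S holds; 0 is a junk value. *)
Definition setmax S : R := xget 0 (S `&` ubound S).

Definition log2 (x : R) : R := ln x / ln 2.

End Maximum.

Section Operators.
Context {R : realType}.
Local Notation C := R[i].

Definition psdmx n (X : 'M[C]_n) : Prop :=
  X \is hermsymmx /\ forall u : 'cV[C]_n, 0 <= (u ^t* *m X *m u) 0 0.

Definition loewner_le n (X Y : 'M[C]_n) : Prop := psdmx (Y - X).

Definition quantum_state n (rho : 'M[C]_n) : Prop := psdmx rho /\ \tr rho = 1.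

(* X^{T_B}: <i j| X^{T_B} |m k> = <i k| X |m j>. *)
Definition ptransB a b (X : 'M[C]_(a * b)) : 'M[C]_(a * b) :=
  \matrix_(x, y)
    let: (i, j) := mxtens_unindex x in
    let: (m, k) := mxtens_unindex y in
    X (mxtens_index (i, k)) (mxtens_index (m, j)).

(* X^{T_{BB'}} for X acting on (A (x) B) (x) (A' (x) B'). *)
Definition ptransBB a b a' b' (X : 'M[C]_((a * b) * (a' * b'))) :
    'M[C]_((a * b) * (a' * b')) :=
  \matrix_(x, y)
    let: (p, p') := mxtens_unindex x in
    let: (q, q') := mxtens_unindex y in
    let: (i, j) := mxtens_unindex p in
    let: (i', j') := mxtens_unindex p' in
    let: (m, k) := mxtens_unindex q in
    let: (m', k') := mxtens_unindex q' in
    X (mxtens_index (mxtens_index (i, k), mxtens_index (i', k')))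
      (mxtens_index (mxtens_index (m, j), mxtens_index (m', j'))).

Definition tens_block n d (X : 'M[C]_(n * d)) (s t : 'I_n) : 'M[C]_d :=
  \matrix_(i, j) X (mxtens_index (s, i)) (mxtens_index (t, j)).

(* (id_n (x) Pi) X, using X = \sum_(s, t) |s><t| (x) tens_block X s t. *)
Definition ampliation n d d' (Pi : 'M[C]_d -> 'M[C]_d') (X : 'M[C]_(n * d)) :
    'M[C]_(n * d') :=
  \sum_(s < n) \sum_(t < n) delta_mx s t *t Pi (tens_block X s t).

Definition completely_positive d d' (Pi : 'M[C]_d -> 'M[C]_d') : Prop :=
  forall n (X : 'M[C]_(n * d)), psdmx X -> psdmx (ampliation Pi X).

Definition trace_preserving d d' (Pi : 'M[C]_d -> 'M[C]_d') : Prop :=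
  forall X : 'M[C]_d, \tr (Pi X) = \tr X.

Definition choi a b a' b' (Pi : 'M[C]_(a * b) -> 'M[C]_(a' * b')) :
    'M[C]_((a * b) * (a' * b')) :=
  \sum_(i < a) \sum_(j < b) \sum_(m < a) \sum_(k < b)
    let E := delta_mx (mxtens_index (i, j)) (mxtens_index (m, k)) in
    E *t Pi E.

Definition ppt_operation a b a' b'
    (Pi : {linear 'M[C]_(a * b) -> 'M[C]_(a' * b')}) : Prop :=
  [/\ completely_positive Pi, trace_preserving Pi & psdmx (ptransBB (choi Pi))].

Definition max_entangled k : 'M[C]_(k * k) :=
  k%:R^-1 *: \sum_(i < k) \sum_(j < k)
    delta_mx (mxtens_index (i, i)) (mxtens_index (j, j)).

Definition ppt_fidelities a b (rho : 'M[C]_(a * b)) (k : nat) : set R :=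
  [set f | exists2 Pi : {linear 'M[C]_(a * b) -> 'M[C]_(k * k)},
     ppt_operation Pi & f%:C = \tr (Pi rho *m max_entangled k)].

Definition fidelity_PPT a b (rho : 'M[C]_(a * b)) (k : nat) : R :=
  setmax (ppt_fidelities rho k).

Definition distillable_dims a b (rho : 'M[C]_(a * b)) (eps : R) : set R :=
  [set k%:R | k in [set k : nat |
     (1 <= k)%N /\ 1 - eps <= fidelity_PPT rho k]].

Definition distillable_entanglement_PPT a b (rho : 'M[C]_(a * b)) (eps : R) : R :=
  log2 (setmax (distillable_dims rho eps)).

(* In the order of R[i], x <= y also asserts that y - x is real; the trace
   below is real since rho and M are Hermitian.  For a state rho and eps < 1
   the constraints force 0 < eta. *)
Definition feasible a b (rho : 'M[C]_(a * b)) (eps eta : R)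
    (M : 'M[C]_(a * b)) : Prop :=
  [/\ M \is hermsymmx,
      loewner_le 0 M /\ loewner_le M 1%:M,
      (1 - eps)%:C <= \tr (rho *m M) &
      loewner_le (- eta%:C%:M) (ptransB M) /\
      loewner_le (ptransB M) (eta%:C%:M)].

Definition feasible_floors a b (rho : 'M[C]_(a * b)) (eps : R) : set R :=
  [set (Num.floor (1 / eta))%:~R | eta in [set eta : R |
     exists M : 'M[C]_(a * b), feasible rho eps eta M]].

End Operators.

(* Main.v *)
(* An operation enters the fidelity only through the image M of the maximally
   entangled state Psi_k under its adjoint, since Tr Pi(rho) Psi_k = Tr rho M.
   As Psi_k^{T_B} is the swap F divided by k and -1 <= F <= 1, positivity of
   T_{B'} o Pi o T_B forces -1/k <= M^{T_B} <= 1/k.  Conversely such an M with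
   0 <= M <= 1 is realized, for k >= 2, by
     X |-> Tr(M X) Psi_k + Tr((1 - M) X) (1 - Psi_k) / (k^2 - 1),
   whose partially transposed Choi matrix is a positive combination of the
   positive operators (1/k +- M^{T_B})^T (x) (1 +- F).  The fidelity is
   therefore the maximum of Tr rho M over a compact set of M.  Finally
   1 - eps <= Tr rho M <= Tr M = Tr M^{T_B} <= eta dim(A (x) B) bounds the
   admissible 1/eta, so all the maxima are over bounded sets of integers. *)

Require Import Defs.
From HB Require Import structures.
From mathcomp Require Import all_boot all_order all_algebra.
From mathcomp Require Import sesquilinear spectral.
From mathcomp.real_closed Require Import complex mxtens.
From mathcomp Require Import all_classical all_reals all_analysis.
From mathcomp Require Import ring lra.

Set Implicit Arguments.
Unset Strict Implicit.
Unset Printing Implicit Defensive.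

Import Order.TTheory GRing.Theory Num.Theory numFieldNormedType.Exports.

Local Open Scope classical_set_scope.
Local Open Scope ring_scope.
Local Open Scope sesquilinear_scope.
Local Open Scope complex_scope.

(** * Positive semidefinite matrices and the trace pairing *)

Section PositiveSemidefinite.
Context {R : realType}.
Local Notation C := R[i].
Implicit Type n : nat.

Lemma trmxC_mul m n p (A : 'M[C]_(m, n)) (B : 'M[C]_(n, p)) :
  (A *m B) ^t* = B ^t* *m A ^t*.
Proof. by rewrite trmx_mul map_mxM. Qed.

Lemma trmxCD m n (A B : 'M[C]_(m, n)) : (A + B) ^t* = A ^t* + B ^t*.
Proof. by rewrite linearD map_mxD. Qed.

Lemma trmxC1 n : 1%:M ^t* = 1%:M :> 'M[C]_n.
Proof. by rewrite trmx1 map_mx1. Qed.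

Lemma hermsymmxP n (X : 'M[C]_n) : reflect (X ^t* = X) (X \is hermsymmx).
Proof.
by apply: (iffP (is_hermitianmxP _ _ _)); rewrite expr0 scale1r => /esym.
Qed.

Lemma formE n (X : 'M[C]_n) (u : 'cV[C]_n) :
  (u ^t* *m X *m u) 0 0 = \tr (u *m u ^t* *m X).
Proof. by rewrite -[X in \tr X]mulmxA mxtrace_mulC /mxtrace big_ord1. Qed.

(** Polarization: the values c = 0, 1, -1, i, -i recover or bound single entries of [X]. *)
Lemma form_delta2 n (X : 'M[C]_n) (x y : 'I_n) (c : C) :
  ((delta_mx x 0 + c *: delta_mx y 0 : 'cV_n) ^t* *m X *m
   (delta_mx x 0 + c *: delta_mx y 0 : 'cV_n)) 0 0 =
  X x x + c * X x y + c^* * X y x + c * c^* * X y y.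
Proof.
have dE (p q : 'I_n) :
    ((delta_mx p 0 : 'cV[C]_n) ^t* *m X *m (delta_mx q 0 : 'cV[C]_n)) 0 0 =
    X p q.
  by rewrite trmx_delta map_delta_mx -rowE -colE !mxE.
have DE (A B : 'M[C]_1) : (A + B) 0 0 = A 0 0 + B 0 0 by rewrite mxE.
have ZE d (A : 'M[C]_1) : (d *: A) 0 0 = d * A 0 0 by rewrite mxE.
rewrite trmxCD linearZ map_mxZ !mulmxDl !mulmxDr -!scalemxAl -!scalemxAr.
rewrite !DE !ZE !dE.
ring.
Qed.

(** Being nonnegative in [R[i]] includes being real, so the form of [D], the adjoint minus [X],
    vanishes identically; polarization then gives [D = 0]. *)
Lemma psd_form n (X : 'M[C]_n) :
  (forall u : 'cV[C]_n, 0 <= (u ^t* *m X *m u) 0 0) -> psdmx X.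
Proof.
move=> Xge0; split => //; apply/hermsymmxP/eqP; rewrite -subr_eq0; apply/eqP.
set D := X ^t* - X.
have D0 (u : 'cV[C]_n) : (u ^t* *m D *m u) 0 0 = 0.
  rewrite /D mulmxBr mulmxBl mxE [X in _ + X]mxE; apply/eqP; rewrite subr_eq0.
  have /ger0_real/CrealP Xr := Xge0 u; rewrite -[X in _ == X]Xr.
  apply/eqP; transitivity (((u ^t* *m X *m u) ^t*) 0 0); last by rewrite !mxE.
  by rewrite !trmxC_mul trmxCK mulmxA.
apply/matrixP => x y; rewrite [RHS]mxE.
clearbody D; have Dd z : D z z = 0.
  have := D0 (delta_mx z 0 + 0 *: delta_mx z 0).
  by rewrite form_delta2 !mul0r rmorph0 !mul0r !addr0.
(* The two vectors give [D x y + D y x = 0] and ['i * (D x y - D y x) = 0]. *)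
have := D0 (delta_mx x 0 + 1 *: delta_mx y 0).
have := D0 (delta_mx x 0 + 'i *: delta_mx y 0).
rewrite !form_delta2 !Dd rmorph1 conjCi !mulr0 !addr0 !add0r !mul1r.
rewrite mulNr -mulrBr => /eqP.
rewrite mulf_eq0 (negPf (neq0Ci _)) subr_eq0 => /eqP ->.
by rewrite -mulr2n => /eqP; rewrite mulrn_eq0 => /eqP.
Qed.

Lemma psd_congr n m (X : 'M[C]_n) (W : 'M[C]_(n, m)) :
  psdmx X -> psdmx (W ^t* *m X *m W).
Proof.
move=> [_ Xge0]; apply: psd_form => u.
by have := Xge0 (W *m u); rewrite trmxC_mul !mulmxA.
Qed.

Lemma psd1 n : psdmx (1%:M : 'M[C]_n).
Proof.
apply: psd_form => u; rewrite mulmx1 mxE sumr_ge0 // => i _.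
by rewrite !mxE mulrC mul_conjC_ge0.
Qed.

Lemma psd_mul_trmxC n m (V : 'M[C]_(n, m)) : psdmx (V *m V ^t*).
Proof.
by have := psd_congr (V ^t*) (psd1 m); rewrite trmxCK mulmx1.
Qed.

Lemma psdD n (X Y : 'M[C]_n) : psdmx X -> psdmx Y -> psdmx (X + Y).
Proof.
move=> [_ hX] [_ hY]; apply: psd_form => u.
by rewrite mulmxDr mulmxDl mxE addr_ge0.
Qed.

Lemma psdZ n (c : C) (X : 'M[C]_n) : 0 <= c -> psdmx X -> psdmx (c *: X).
Proof.
move=> c0 [_ hX]; apply: psd_form => u.
by rewrite -scalemxAr -scalemxAl mxE mulr_ge0.
Qed.

Lemma psd0 n : psdmx (0 : 'M[C]_n).
Proof. by rewrite -(scale0r 1%:M); apply: psdZ => //; apply: psd1. Qed.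

(** Rank-one tests suffice. Together with [psd_tr_mul] this is the self-duality of the positive
    cone, through which positivity is transported along adjoints of maps. *)
Lemma psd_tr_form n (X : 'M[C]_n) :
  (forall Y, psdmx Y -> 0 <= \tr (Y *m X)) -> psdmx X.
Proof.
by move=> h; apply: psd_form => u; rewrite formE; apply/h/psd_mul_trmxC.
Qed.

Lemma psd_diag n (s : 'rV[C]_n) : (forall j, 0 <= s 0 j) -> psdmx (diag_mx s).
Proof.
move=> s0; apply: psd_form => u; rewrite mul_mx_diag mxE sumr_ge0 // => i _.
by rewrite !mxE mulrAC mulr_ge0 // mulrC mul_conjC_ge0.
Qed.

Lemma psd_spectral n (X : 'M[C]_n) : psdmx X ->
  exists (P : 'M[C]_n) (s : 'rV[C]_n),
    [/\ P \is unitarymx, X = P ^t* *m diag_mx s *m P & forall j, 0 <= s 0 j].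
Proof.
move=> [hX Xge0]; have /orthomx_spectralP := hermitian_normalmx hX.
have Pu := spectral_unitarymx X; set P := spectralmx X in Pu *.
set s := spectral_diag X; rewrite invmx_unitary // => XE.
exists P, s; split => // j.
have := Xge0 (P ^t* *m delta_mx j 0).
rewrite trmxC_mul trmxCK XE !mulmxA -(mulmxA _ P) (unitarymxP Pu) mulmx1.
rewrite -(mulmxA _ P) (unitarymxP Pu) mulmx1.
by rewrite trmx_delta map_delta_mx -rowE -colE !mxE eqxx.
Qed.

(** Take square roots of the eigenvalues in the spectral decomposition. *)
Lemma psd_gram n (X : 'M[C]_n) : psdmx X -> exists V : 'M[C]_n, X = V *m V ^t*.
Proof.
move=> /psd_spectral [P [s [Pu XE s0]]].
pose D := diag_mx (\row_j sqrtC (s 0 j)).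
exists (P ^t* *m D); rewrite trmxC_mul trmxCK XE !mulmxA; congr (_ *m P).
rewrite -[RHS]mulmxA; congr (_ *m _).
rewrite /D tr_diag_mx map_diag_mx mulmx_diag; congr diag_mx.
apply/rowP => j; rewrite !mxE.
have sr : Num.conj (sqrtC (s 0 j)) = sqrtC (s 0 j).
  by apply/CrealP/ger0_real; rewrite sqrtC_ge0.
by rewrite [X in _ * X]sr -expr2 sqrtCK.
Qed.

(** Each eigenvalue is at most the sum of all, as none is negative. In particular a state is bounded
    by the identity. *)
Lemma psd_le_tr n (X : 'M[C]_n) : psdmx X -> psdmx ((\tr X)%:M - X).
Proof.
move=> /psd_spectral [P [s [Pu XE s0]]].
have PtP : P ^t* *m P = 1%:M.
  by rewrite -[P ^t*]invmx_unitary // mulVmx // unitarymx_unit.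
have trX : \tr X = \sum_j s 0 j.
  by rewrite XE mxtrace_mulC mulmxA (unitarymxP Pu) mul1mx mxtrace_diag.
have -> : (\tr X)%:M - X = P ^t* *m diag_mx (const_mx (\tr X) - s) *m P.
  rewrite linearB /= diag_const_mx mulmxBr mulmxBl -XE.
  by rewrite mul_mx_scalar -scalemxAl PtP scalemx1.
apply/psd_congr/psd_diag => j.
rewrite !mxE trX (bigD1 j) //= addrAC subrr add0r.
exact: sumr_ge0.
Qed.

(** Writing X = V V^*, cyclicity turns the trace into the sum of the forms of [Y] at the columns of
    V. *)
Lemma psd_tr_mul n (X Y : 'M[C]_n) : psdmx X -> psdmx Y -> 0 <= \tr (X *m Y).
Proof.
move=> /psd_gram [V ->] [_ Yge0].
rewrite -mulmxA mxtrace_mulC; apply: sumr_ge0 => i _.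
have := Yge0 (col i V); congr (0 <= _).
rewrite !mxE; apply: eq_bigr => j _; rewrite !mxE.
by congr (_ * _); apply: eq_bigr => l _; rewrite !mxE.
Qed.

Lemma psd_tens m n (X : 'M[C]_m) (Y : 'M[C]_n) :
  psdmx X -> psdmx Y -> psdmx (X *t Y).
Proof.
move=> /psd_gram [V ->] /psd_gram [W ->].
by rewrite -tensmx_mul -map_mxT -trmx_tens; apply: psd_mul_trmxC.
Qed.

Lemma psd_diag_ge0 n (X : 'M[C]_n) x : psdmx X -> 0 <= X x x.
Proof.
move=> [_ /(_ (delta_mx x 0 + 0 *: delta_mx x 0))].
by rewrite form_delta2 !mul0r rmorph0 !mul0r !addr0.
Qed.

End PositiveSemidefinite.

(** * Transposition and partial transposition *)

Section PartialTranspose.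
Context {R : realType}.
Local Notation C := R[i].

Lemma psd_trmx n (X : 'M[C]_n) : psdmx X -> psdmx X^T.
Proof.
move=> /psd_gram [V ->]; rewrite trmx_mul.
have -> : (V ^t*)^T = map_mx Num.conj V by apply/matrixP => i j; rewrite !mxE.
have -> : V^T = (map_mx Num.conj V) ^t*.
  by apply/matrixP => i j; rewrite !mxE /= conjCK.
exact: psd_mul_trmxC.
Qed.

Lemma sum_mxtens (V : nmodType) m n (F : 'I_(m * n) -> V) :
  \sum_k F k = \sum_i \sum_j F (mxtens_index (i, j)).
Proof.
rewrite pair_big /= (reindex (@mxtens_index m n)) /=.
  by apply: eq_bigr => -[].
exists (@mxtens_unindex m n) => x _.
  exact: mxtens_indexK.
exact: mxtens_unindexK.
Qed.

Lemma tr_mulE n (X Y : 'M[C]_n) : \tr (X *m Y) = \sum_x \sum_y X x y * Y y x.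
Proof. by apply: eq_bigr => x _; rewrite mxE. Qed.

Context {a b : nat}.
Implicit Types X Y M : 'M[C]_(a * b).

Lemma ptransBE X i j m k :
  ptransB X (mxtens_index (i, j)) (mxtens_index (m, k)) =
  X (mxtens_index (i, k)) (mxtens_index (m, j)).
Proof. by rewrite mxE !mxtens_indexK. Qed.

Lemma ptransB_is_linear : linear (@ptransB R a b).
Proof.
move=> c X Y; apply/matrixP => x y.
case: (mxtens_indexP x) => i j; case: (mxtens_indexP y) => m k.
by rewrite ptransBE !mxE !mxtens_indexK.
Qed.

HB.instance Definition _ := GRing.isLinear.Build C 'M[C]_(a * b) 'M[C]_(a * b)
  _ (@ptransB R a b) ptransB_is_linear.

Lemma ptransBK : involutive (@ptransB R a b).
Proof.
move=> X; apply/matrixP => x y.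
case: (mxtens_indexP x) => i j; case: (mxtens_indexP y) => m k.
by rewrite !ptransBE.
Qed.

Lemma ptransB1 : ptransB 1%:M = 1%:M :> 'M[C]_(a * b).
Proof.
apply/matrixP => x y.
case: (mxtens_indexP x) => i j; case: (mxtens_indexP y) => m k.
rewrite ptransBE !mxE !(can_eq (@mxtens_indexK _ _)) !xpair_eqE.
by rewrite (eq_sym k).
Qed.

(** Both sides sum the same products once the two summation indices on B are exchanged. *)
Lemma tr_ptransB_mul X Y : \tr (ptransB X *m Y) = \tr (X *m ptransB Y).
Proof.
rewrite !tr_mulE !sum_mxtens; apply: eq_bigr => i _.
under eq_bigr do rewrite sum_mxtens.
under [RHS]eq_bigr do rewrite sum_mxtens.
rewrite exchange_big [RHS]exchange_big /=; apply: eq_bigr => m _.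
rewrite exchange_big /=; apply: eq_bigr => k _; apply: eq_bigr => j _.
by rewrite !ptransBE.
Qed.

Lemma tr_ptransB X : \tr (ptransB X) = \tr X.
Proof. by rewrite -[ptransB X]mulmx1 tr_ptransB_mul ptransB1 mulmx1. Qed.

End PartialTranspose.

(** * Choi matrices and complete positivity *)

Section Choi.
Context {R : realType}.
Local Notation C := R[i].

Lemma ampliationE n d d' (Phi : 'M[C]_d -> 'M[C]_d') (X : 'M[C]_(n * d))
    s t i j :
  ampliation Phi X (mxtens_index (s, i)) (mxtens_index (t, j)) =
  Phi (tens_block X s t) i j.
Proof.
rewrite summxE (bigD1 s) //= [X in _ + X]big1 ?addr0; last first.
  move=> s' ns; rewrite summxE big1 // => t' _.
  by rewrite tensmxE mxE eq_sym (negPf ns) mul0r.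
rewrite summxE (bigD1 t) //= [X in _ + X]big1 ?addr0; last first.
  by move=> t' nt; rewrite tensmxE mxE andbC eq_sym (negPf nt) mul0r.
by rewrite tensmxE mxE !eqxx mul1r.
Qed.

(** The unnormalized maximally entangled vector, the sum of the |i i>. *)
Definition bell n : 'cV[C]_(n * n) :=
  \col_x ((mxtens_unindex x).1 == (mxtens_unindex x).2)%:R.

Definition omega n : 'M[C]_(n * n) := bell n *m (bell n) ^t*.

Lemma omegaE n i j m k :
  omega n (mxtens_index (i, j)) (mxtens_index (m, k)) =
  ((i == j) && (m == k))%:R.
Proof.
by rewrite !mxE big_ord1 !mxE !mxtens_indexK /= conjC_nat -natrM mulnb.
Qed.

Lemma max_entangledE n : max_entangled n = n%:R^-1 *: omega n.
Proof.
congr (_ *: _); apply/matrixP => x y.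
case: (mxtens_indexP x) => i j; case: (mxtens_indexP y) => m k.
rewrite omegaE summxE (bigD1 i) //= [X in _ + X]big1 ?addr0; last first.
  move=> s ns; rewrite summxE big1 // => t _.
  by rewrite mxE !(can_eq (@mxtens_indexK _ _)) !xpair_eqE eq_sym (negPf ns).
rewrite summxE (bigD1 m) //= [X in _ + X]big1 ?addr0; last first.
  move=> t nt; rewrite mxE !(can_eq (@mxtens_indexK _ _)) !xpair_eqE.
  by rewrite [m == t]eq_sym (negPf nt) andbF.
rewrite mxE !(can_eq (@mxtens_indexK _ _)) !xpair_eqE !eqxx /=.
by rewrite (eq_sym j) (eq_sym k).
Qed.

Lemma tens_block_omega n s t : tens_block (omega n) s t = delta_mx s t.
Proof.
by apply/matrixP => i j; rewrite [LHS]mxE omegaE mxE (eq_sym s) (eq_sym t).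
Qed.

(** The blocks of [omega] are the matrix units. *)
Lemma choiE a b a' b' (Pi : 'M[C]_(a * b) -> 'M[C]_(a' * b')) :
  choi Pi = ampliation Pi (omega (a * b)).
Proof.
rewrite /ampliation sum_mxtens; apply: eq_bigr => i _; apply: eq_bigr => j _.
rewrite sum_mxtens; apply: eq_bigr => m _; apply: eq_bigr => k _ /=.
by rewrite tens_block_omega.
Qed.

Lemma ptransB_delta a b (i m : 'I_a) (j k : 'I_b) :
  ptransB (delta_mx (mxtens_index (i, j)) (mxtens_index (m, k))) =
  delta_mx (mxtens_index (i, k)) (mxtens_index (m, j)) :> 'M[C]_(a * b).
Proof.
apply/matrixP => x y.
case: (mxtens_indexP x) => i' j'; case: (mxtens_indexP y) => m' k'.
rewrite ptransBE !mxE !(can_eq (@mxtens_indexK _ _)) !xpair_eqE.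
by rewrite !andbA; congr (_%:R); rewrite andbAC -!andbA; do ![case: eqP => //].
Qed.

(** Partial transposition permutes the matrix units, so the partially transposed Choi matrix of [Pi]
    is the Choi matrix of T_{B'} o Pi o T_B. *)
Lemma ptransBB_choi a b a' b' (Pi : 'M[C]_(a * b) -> 'M[C]_(a' * b')) :
  ptransBB (choi Pi) =
  ampliation (fun X => ptransB (Pi (ptransB X))) (omega (a * b)).
Proof.
rewrite choiE; apply/matrixP => x y.
case: (mxtens_indexP x) => p p'; case: (mxtens_indexP y) => q q'.
rewrite ampliationE mxE !mxtens_indexK tens_block_omega.
case: (mxtens_indexP p) => i j; case: (mxtens_indexP q) => m k.
case: (mxtens_indexP p') => i' j'; case: (mxtens_indexP q') => m' k'.
rewrite !mxtens_indexK ampliationE tens_block_omega ptransBE.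
by rewrite ptransB_delta.
Qed.

(** Inverts the Choi correspondence: [Phi] is recovered by pairing its Choi matrix with product
    operators. *)
Lemma tr_ampliation_omega n d (Phi : {linear 'M[C]_n -> 'M[C]_d}) X Y :
  \tr ((X^T *t Y) *m ampliation Phi (omega n)) = \tr (Y *m Phi X).
Proof.
rewrite tr_mulE sum_mxtens tr_mulE.
under eq_bigr => p _.
  under eq_bigr => p' _.
    rewrite sum_mxtens.
    under eq_bigr => q _.
      under eq_bigr => q' _ do
        rewrite tensmxE ampliationE tens_block_omega mxE mulrAC -mulrA mulrC.
      over.
    over.
  over.
rewrite /= exchange_big /=; apply: eq_bigr => p' _.
under eq_bigr do rewrite exchange_big /=.
rewrite exchange_big /=; apply: eq_bigr => q' _.
rewrite [in RHS](matrix_sum_delta X) linear_sum summxE mulr_sumr.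
rewrite exchange_big /=; apply: eq_bigr => p _.
rewrite linear_sum summxE mulr_sumr; apply: eq_bigr => q _.
by rewrite linearZ mxE /=; ring.
Qed.

Lemma choi_psd_positive n d (Phi : {linear 'M[C]_n -> 'M[C]_d}) X :
  psdmx (ampliation Phi (omega n)) -> psdmx X -> psdmx (Phi X).
Proof.
move=> hPhi hX; apply: psd_tr_form => Y hY.
rewrite -tr_ampliation_omega.
exact: (psd_tr_mul (psd_tens (psd_trmx hX) hY) hPhi).
Qed.

Lemma psd_omega n : psdmx (omega n).
Proof. exact: psd_mul_trmxC. Qed.

Lemma completely_positiveD d d' (Phi Psi : 'M[C]_d -> 'M[C]_d') :
  completely_positive Phi -> completely_positive Psi ->
  completely_positive (fun X => Phi X + Psi X).
Proof.
move=> hPhi hPsi n X hX.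
have -> : ampliation (fun X => Phi X + Psi X) X =
    ampliation Phi X + ampliation Psi X.
  apply/matrixP => x y; case: (mxtens_indexP x) => s i.
  by case: (mxtens_indexP y) => t j; rewrite mxE !ampliationE mxE.
by apply: psdD; [apply: hPhi | apply: hPsi].
Qed.

(** The amplified map sends X to Y (x) Z, where Y is the partial trace of (1 (x) A) X. By duality Y
    is positive, since Tr B Y = Tr (B (x) A) X. *)
Lemma measure_prepare_cp d d' (A : 'M[C]_d) (Z : 'M[C]_d') :
  psdmx A -> psdmx Z -> completely_positive (fun X => \tr (A *m X) *: Z).
Proof.
move=> hA hZ n X hX.
pose Y := \matrix_(s, t) \tr (A *m tens_block X s t).
have -> : ampliation (fun X => \tr (A *m X) *: Z) X = Y *t Z.
  apply/matrixP => x y; case: (mxtens_indexP x) => s i.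
  by case: (mxtens_indexP y) => t j; rewrite tensmxE ampliationE !mxE.
apply: psd_tens hZ; apply: psd_tr_form => B hB.
have -> : \tr (B *m Y) = \tr ((B *t A) *m X); last first.
  by apply: psd_tr_mul hX; apply: psd_tens.
rewrite !tr_mulE sum_mxtens; apply: eq_bigr => s _.
under [RHS]eq_bigr do rewrite sum_mxtens.
rewrite [RHS]exchange_big /=; apply: eq_bigr => t _.
rewrite mxE tr_mulE mulr_sumr; apply: eq_bigr => i _.
rewrite mulr_sumr; apply: eq_bigr => j _.
by rewrite tensmxE mxE mulrA.
Qed.

End Choi.

(** * The swap operator; PPT operations versus test operators *)

Section Twirling.
Context {R : realType}.
Local Notation C := R[i].

(** Half of 1 + H is a Hermitian projection, so 1 + H is half its own square. *)
Lemma psd_involution n (H : 'M[C]_n) :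
  H ^t* = H -> H *m H = 1%:M -> psdmx (1%:M + H).
Proof.
move=> hH HH; have -> : 1%:M + H = 2^-1 *: ((1%:M + H) *m (1%:M + H) ^t*).
  rewrite trmxCD trmxC1 hH mulmxDl !mulmxDr !mulmx1 mul1mx HH.
  rewrite [H + 1%:M]addrC -mulr2n -(scaler_nat 2 (_ + _)) scalerA.
  by rewrite mulVf ?scale1r ?pnatr_eq0.
by apply: psdZ; [rewrite invr_ge0 ler0n | apply: psd_mul_trmxC].
Qed.

(** The flip |i j> to |j i>. *)
Definition swapmx n : 'M[C]_(n * n) := ptransB (omega n).

Lemma swapmxE n i j m k :
  swapmx n (mxtens_index (i, j)) (mxtens_index (m, k)) =
  ((i == k) && (m == j))%:R.
Proof. by rewrite ptransBE omegaE. Qed.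

Lemma swapmx_herm n : (swapmx n) ^t* = swapmx n.
Proof.
apply/matrixP => x y; case: (mxtens_indexP x) => i j.
case: (mxtens_indexP y) => m k; rewrite 2!mxE !swapmxE /= conjC_nat.
by rewrite andbC (eq_sym m) (eq_sym i).
Qed.

Lemma swapmxK n : swapmx n *m swapmx n = 1%:M.
Proof.
apply/matrixP => x y; case: (mxtens_indexP x) => i j.
case: (mxtens_indexP y) => m k; rewrite mxE sum_mxtens.
rewrite (bigD1 j) //= [X in _ + X]big1 ?addr0; last first.
  move=> s ns; rewrite big1 // => t _.
  by rewrite swapmxE (negPf ns) andbF mul0r.
rewrite (bigD1 i) //= [X in _ + X]big1 ?addr0; last first.
  by move=> t nt; rewrite swapmxE eq_sym (negPf nt) mul0r.
rewrite !swapmxE !eqxx mul1r mxE (can_eq (@mxtens_indexK _ _)) xpair_eqE.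
by rewrite andbC (eq_sym i).
Qed.

Lemma psd_1D_swapmx n : psdmx (1%:M + swapmx n).
Proof. exact: (psd_involution (swapmx_herm n) (swapmxK n)). Qed.

Lemma psd_1B_swapmx n : psdmx (1%:M - swapmx n).
Proof.
apply: psd_involution; last by rewrite mulmxN mulNmx opprK swapmxK.
by rewrite -{2}(swapmx_herm n) linearN /= map_mxN.
Qed.

Lemma ptransB_max_entangled n : ptransB (max_entangled n) = n%:R^-1 *: swapmx n.
Proof. by rewrite max_entangledE linearZ. Qed.

Lemma tr_omega n : \tr (omega n) = n%:R :> C.
Proof.
rewrite /mxtrace sum_mxtens.
under eq_bigr => i _.
  rewrite (bigD1 i) //= big1 ?addr0.
    by rewrite omegaE eqxx; over.
  by move=> j nj; rewrite omegaE eq_sym (negPf nj).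
by rewrite sumr_const card_ord.
Qed.

Lemma omega_sqr n : omega n *m omega n = n%:R *: omega n :> 'M[C]_(n * n).
Proof.
rewrite -tr_omega /omega; set B := bell n : 'cV[C]__.
rewrite mulmxA -(mulmxA B) [B ^t* *m B]mx11_scalar mul_mx_scalar -scalemxAl.
by congr (_ *: _); rewrite mxtrace_mulC /mxtrace big_ord1.
Qed.

Lemma tr_max_entangled n : (0 < n)%N -> \tr (max_entangled n) = 1 :> C.
Proof.
by move=> n0; rewrite max_entangledE mxtraceZ tr_omega mulVf // pnatr_eq0 -lt0n.
Qed.

Lemma max_entangled_sqr n : (0 < n)%N ->
  max_entangled n *m max_entangled n = max_entangled n :> 'M[C]_(n * n).
Proof.
move=> n0; rewrite !max_entangledE -scalemxAl -scalemxAr omega_sqr !scalerA.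
by rewrite -mulrA mulVf ?mulr1 // pnatr_eq0 -lt0n.
Qed.

Lemma psd_max_entangled n : psdmx (max_entangled n : 'M[C]_(n * n)).
Proof.
rewrite max_entangledE; apply: psdZ (psd_omega n).
by rewrite invr_ge0 ler0n.
Qed.

Lemma psd_1B_max_entangled n : (0 < n)%N ->
  psdmx (1%:M - max_entangled n : 'M[C]_(n * n)).
Proof.
by move=> n0; rewrite -(tr_max_entangled n0); apply/psd_le_tr/psd_max_entangled.
Qed.

Context {a b : nat}.
Implicit Type M : 'M[C]_(a * b).

(** The constraints on [M] that do not mention the state. For eta = 1/k with k >= 2 they describe
    exactly the pullbacks of Psi_k along PPT operations. *)
Definition ppt_test M (eta : R) :=
  [/\ psdmx M, psdmx (1%:M - M), psdmx (eta%:C%:M + ptransB M) &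
      psdmx (eta%:C%:M - ptransB M)].

Lemma invn_C (k : nat) : (k%:R^-1 : R)%:C = k%:R^-1.
Proof. by rewrite fmorphV rmorph_nat. Qed.

Lemma ppt_operation_test k (Pi : {linear 'M[C]_(a * b) -> 'M[C]_(k * k)}) :
    (0 < k)%N -> ppt_operation Pi ->
  exists2 M, ppt_test M k%:R^-1 &
    forall X, \tr (Pi X *m max_entangled k) = \tr (X *m M).
Proof.
move=> k0 [cpPi tpPi pptPi].
(* The indices are swapped so that Tr X M expands Tr Pi(X) Psi_k over matrix units. *)
pose M := \matrix_(p, q) \tr (Pi (delta_mx q p) *m max_entangled k).
have ME X : \tr (Pi X *m max_entangled k) = \tr (X *m M).
  rewrite [RHS]tr_mulE {1}(matrix_sum_delta X).
  rewrite linear_sum mulmx_suml raddf_sum /=; apply: eq_bigr => p _.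
  rewrite linear_sum mulmx_suml raddf_sum /=.
  apply: eq_bigr => q _.
  by rewrite [Pi _]linearZ /= -scalemxAl mxtraceZ mxE.
have posPi X : psdmx X -> psdmx (Pi X).
  exact: (choi_psd_positive (cpPi _ _ (psd_omega _))).
pose Theta : {linear _ -> _} :=
  (@ptransB R k k : {linear _ -> _}) \o Pi \o (@ptransB R a b).
have pptT : psdmx (ampliation Theta (omega (a * b))).
  by rewrite ptransBB_choi in pptPi.
have posT X : psdmx X -> psdmx (Theta X) by exact: (choi_psd_positive pptT).
have trT X : \tr (Theta X) = \tr X by rewrite /= tr_ptransB tpPi tr_ptransB.
(* Through this identity the bounds on M^{T_B} reduce to Tr Theta(Y) (1 +- F) >= 0, where [Theta] is
   positive and preserves the trace. *)
have MT X : \tr (X *m ptransB M) = k%:R^-1 * \tr (Theta X *m swapmx k).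
  rewrite -tr_ptransB_mul -ME -[max_entangled k]ptransBK -tr_ptransB_mul.
  by rewrite ptransB_max_entangled -scalemxAr mxtraceZ.
have k0C : 0 <= k%:R^-1 :> C by rewrite invr_ge0 ler0n.
exists M => //; split; apply: psd_tr_form => Y hY.
- by rewrite -ME psd_tr_mul //; [apply: posPi | apply: psd_max_entangled].
- rewrite mulmxBr mulmx1 linearB /= -ME -tpPi -{1}(mulmx1 (Pi Y)) -linearB /=.
  rewrite -mulmxBr psd_tr_mul //; first exact: posPi.
  exact: psd_1B_max_entangled.
- rewrite mulmxDr mxtraceD MT mul_mx_scalar mxtraceZ invn_C -mulrDr -trT.
  rewrite mulr_ge0 // -{1}(mulmx1 (Theta Y)) -mxtraceD -mulmxDr.
  by apply: psd_tr_mul; [apply: posT | apply: psd_1D_swapmx].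
- rewrite mulmxBr linearB /= MT mul_mx_scalar mxtraceZ invn_C -mulrBr -trT.
  rewrite mulr_ge0 // -{1}(mulmx1 (Theta Y)) -linearB /= -mulmxBr.
  by apply: psd_tr_mul; [apply: posT | apply: psd_1B_swapmx].
Qed.

(** An equality of functions allows statements about the bundled map to be rewritten to the explicit
    formula. *)
Lemma linear_pack m n (f : 'M[C]_m -> 'M[C]_n) : linear f ->
  exists g : {linear 'M[C]_m -> 'M[C]_n}, g = f :> (_ -> _).
Proof.
move=> lf; pose L := GRing.isLinear.Build C 'M[C]_m 'M[C]_n _ f lf.
by exists (HB.pack_for {linear 'M[C]_m -> 'M[C]_n} f L).
Qed.

(** The bound k > 1 makes K - 1 and K^2 - 1 positive; at k = 1 the complement of Psi_k is zero and
    cannot be normalized. *)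
Lemma test_ppt_operation k M : (1 < k)%N -> ppt_test M k%:R^-1 ->
  exists2 Pi : {linear 'M[C]_(a * b) -> 'M[C]_(k * k)}, ppt_operation Pi &
    forall X, \tr (Pi X *m max_entangled k) = \tr (X *m M).
Proof.
move=> k1 [M0 M1 MT0 MT1]; have k0 : (0 < k)%N by apply: ltnW.
pose K : C := k%:R.
have K0 : K != 0 by rewrite pnatr_eq0 -lt0n.
have Km : 0 < K - 1 by rewrite subr_gt0 ltr1n.
have Kp : 0 < K + 1 by rewrite ltr_wpDl ?ler0n.
have KK : 0 < K * K - 1.
  have -> : K * K - 1 = (K - 1) * (K + 1) by ring.
  exact: mulr_gt0.
pose Psi : 'M[C]_(k * k) := max_entangled k.
(* The complementary projection has rank k^2 - 1, so [Q] has trace 1; it is orthogonal to Psi_k. *)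
pose Q := (K * K - 1)^-1 *: (1%:M - Psi).
pose f X := \tr (M *m X) *: Psi + \tr ((1%:M - M) *m X) *: Q.
have lf : linear f.
  move=> c X Y; rewrite /f !mulmxDr -!scalemxAr !mxtraceD !mxtraceZ !scalerDl.
  by rewrite scalerDr !scalerA addrACA.
have [Pi PiE] := linear_pack lf.
have trPsi : \tr Psi = 1 by apply: tr_max_entangled.
have trQ : \tr Q = 1.
  rewrite mxtraceZ linearB /= mxtrace1 trPsi natrM mulVf //.
  exact: lt0r_neq0.
have PsiPsi : Psi *m Psi = Psi by apply: max_entangled_sqr.
have QPsi : Q *m Psi = 0.
  by rewrite -scalemxAl mulmxBl mul1mx PsiPsi subrr scaler0.
exists Pi; last first.
  move=> X; rewrite PiE /f; set s := \tr ((_ - _) *m _).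
  rewrite mulmxDl -/Psi -(scalemxAl _ Psi) -(scalemxAl s).
  rewrite QPsi PsiPsi scaler0 addr0.
  by rewrite mxtraceZ trPsi mulr1 mxtrace_mulC.
split.
- rewrite PiE; apply: completely_positiveD; apply: measure_prepare_cp => //.
    exact: psd_max_entangled.
  apply: psdZ; last exact: psd_1B_max_entangled.
  by rewrite invr_ge0 ltW.
- move=> X; rewrite PiE /f mxtraceD (mxtraceZ _ Psi) (mxtraceZ _ Q) trPsi trQ.
  rewrite !mulr1 -mxtraceD.
  by rewrite -mulmxDl addrC subrK mul1mx.
- rewrite ptransBB_choi.
  have ptQ : ptransB Q = (K * K - 1)^-1 *: (1%:M - k%:R^-1 *: swapmx k).
    by rewrite linearZ linearB /= ptransB1 ptransB_max_entangled.
  (* [A] and [B] come from expanding Psi_k^{T_B} = F/k and Q^{T_B} in the basis 1 + F, 1 - F and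
     solving for the two coefficients. *)
  pose A := (2 * (K + 1))^-1 *: ((k%:R^-1 : R)%:C%:M + ptransB M).
  pose B := (2 * (K - 1))^-1 *: ((k%:R^-1 : R)%:C%:M - ptransB M).
  have -> : (fun X => ptransB (Pi (ptransB X))) =
      (fun X => \tr (A *m X) *: (1%:M + swapmx k) +
                \tr (B *m X) *: (1%:M - swapmx k)).
    apply/funext => X; rewrite PiE /f mulmxBl mul1mx linearB /= -tr_ptransB_mul.
    rewrite tr_ptransB linearD [X in X + _ = _]linearZ.
    rewrite [X in _ + X = _]linearZ /= ptQ.
    rewrite ptransB_max_entangled /A /B -!scalemxAl !mxtraceZ.
    rewrite mulmxDl mulmxBl mxtraceD [\tr (_ - _)]linearB /=.
    rewrite mul_scalar_mx mxtraceZ invn_C.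
    move: (swapmx k) (\tr (ptransB M *m X)) (\tr X) => F t s.
    apply/matrixP => x y; rewrite !mxE -/K.
    move: (_ == _)%:R (F x y) => u v.
    by field; rewrite ?K0 ?lt0r_neq0.
  apply: completely_positiveD (psd_omega _); apply: measure_prepare_cp.
  + by apply: psdZ => //; rewrite invr_ge0 ltW // mulr_gt0 // ltr0n.
  + exact: psd_1D_swapmx.
  + by apply: psdZ => //; rewrite invr_ge0 ltW // mulr_gt0 // ltr0n.
  + exact: psd_1B_swapmx.
Qed.

(** Discards the input and prepares [Z]; this supplies the case k = 1. *)
Lemma trace_replace_ppt k (Z : 'M[C]_(k * k)) :
    psdmx Z -> psdmx (ptransB Z) -> \tr Z = 1 ->
  exists2 Pi : {linear 'M[C]_(a * b) -> 'M[C]_(k * k)}, ppt_operation Pi &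
    forall X, Pi X = \tr X *: Z.
Proof.
move=> hZ hZT trZ.
have [|Pi PiE] := @linear_pack (a * b) (k * k) (fun X => \tr (1%:M *m X) *: Z).
  by move=> c X Y; rewrite !mul1mx mxtraceD mxtraceZ scalerDl scalerA.
exists Pi; last by move=> X; rewrite PiE mul1mx.
split.
- by rewrite PiE; apply: measure_prepare_cp => //; apply: psd1.
- by move=> X; rewrite PiE mul1mx mxtraceZ trZ mulr1.
- rewrite ptransBB_choi.
  have -> : (fun X => ptransB (Pi (ptransB X))) =
      (fun X => \tr (1%:M *m X) *: ptransB Z).
    by apply/funext => X; rewrite PiE linearZ /= !mul1mx tr_ptransB.
  by apply: measure_prepare_cp (psd_omega _) => //; apply: psd1.
Qed.

End Twirling.

(** * Closed and bounded sets of operators in real coordinates *)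

Lemma continuous_sum (T : topologicalType) (R : realType) (I : finType)
    (g : I -> T -> R^o) :
  (forall i, continuous (g i)) -> continuous (fun v => \sum_i g i v).
Proof.
move=> gc; elim: (index_enum I) => [|i r IH].
  under [fun=> _]eq_fun do rewrite big_nil.
  by move=> v; apply: cvg_cst.
under [fun=> _]eq_fun do rewrite big_cons.
by move=> v; apply: cvgD; [apply: gc | apply: IH].
Qed.

Lemma continuous_lin2 (T : topologicalType) (R : realType) (p q : R)
    (f g : T -> R^o) :
  continuous f -> continuous g -> continuous (fun v => p * f v - q * g v : R^o).
Proof.
move=> fc gc v; apply: cvgB.
  by apply: cvgM; [apply: cvg_cst | apply: fc].
by apply: cvgM; [apply: cvg_cst | apply: gc].
Qed.

Section Compactness.
Context {R : realType}.
Local Notation C := R[i].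
Context {n : nat}.

Local Notation coords := {ptws 'I_n * 'I_n * bool -> R}.

(** Real and imaginary parts of the entries are points of a product of copies of R, where
    Tychonoff's theorem gives compact boxes. *)
Definition mx_of_coords (v : coords) : 'M[C]_n :=
  \matrix_(x, y) (v (x, y, false) +i* v (x, y, true)).

Lemma Re_tr_mx_of_coords (X : 'M[C]_n) v :
  complex.Re (\tr (X *m mx_of_coords v)) =
  \sum_x \sum_y (complex.Re (X x y) * v (y, x, false) -
                 complex.Im (X x y) * v (y, x, true)).
Proof.
rewrite tr_mulE (raddf_sum (@complex.Re R : Rcomplex R -> R)).
apply: eq_bigr => x _.
rewrite (raddf_sum (@complex.Re R : Rcomplex R -> R)).
by apply: eq_bigr => y _; rewrite mxE; case: (X x y).
Qed.

Lemma continuous_Re_tr (X : 'M[C]_n) :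
  continuous (fun v : coords => complex.Re (\tr (X *m mx_of_coords v)) : R^o).
Proof.
rewrite (_ : (fun v => _) = (fun v : coords => \sum_x \sum_y
    (complex.Re (X x y) * v (y, x, false) -
     complex.Im (X x y) * v (y, x, true)))); last first.
  by apply/funext => v; rewrite Re_tr_mx_of_coords.
apply: continuous_sum => x; apply: continuous_sum => y v.
have pc t : continuous (fun w : coords => w t : R^o).
  exact: (@proj_continuous _ (fun=> R) t).
apply: continuous_lin2; exact: pc.
Qed.

(** The order of [R[i]] also forces a zero imaginary part, hence three real inequalities; imaginary
    parts become real parts after multiplication by i or -i. *)
Lemma closed_tr_ge0 (X : 'M[C]_n) (z : C) :
  closed [set v : coords | 0 <= z + \tr (X *m mx_of_coords v)].
Proof.
have cRe (Y : 'M[C]_n) (r : R) :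
    closed [set v : coords | r <= complex.Re (\tr (Y *m mx_of_coords v))].
  have /continuous_closedP := @continuous_Re_tr Y.
  by move=> /(_ _ (@closed_ge R r)).
rewrite (_ : mkset _ =
  [set v : coords | - complex.Re z <=
      complex.Re (\tr (X *m mx_of_coords v))] `&`
  ([set v : coords | complex.Im z <=
      complex.Re (\tr (('i *: X) *m mx_of_coords v))] `&`
   [set v : coords | - complex.Im z <=
      complex.Re (\tr ((- 'i *: X) *m mx_of_coords v))])).
  by do ![apply: closedI]; apply: cRe.
apply/seteqP; split => v /=; rewrite -!scalemxAl !mxtraceZ;
  move: (\tr _) => [p q]; case: z => [r s]; rewrite lecE /=;
  rewrite ?mul0r ?mul1r ?oppr0 ?mul0r ?mulN1r ?sub0r.
- by move=> /andP[/eqP h1 h2]; split; [lra|split; lra].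
- by move=> [h1 [h2 h3]]; apply/andP; split; [apply/eqP; lra | lra].
Qed.

(** For affine [f] with adjoint linear part [g], duality makes the set an intersection of closed
    conditions, one for each positive [Y]. *)
Lemma closed_psd m (f : 'M[C]_n -> 'M[C]_m) (g : 'M[C]_m -> 'M[C]_n)
    (z : 'M[C]_m -> C) :
    (forall Y M, \tr (Y *m f M) = z Y + \tr (g Y *m M)) ->
  closed [set v : coords | psdmx (f (mx_of_coords v))].
Proof.
move=> fg; rewrite (_ : mkset _ = \bigcap_(Y in [set Y | psdmx Y])
  [set v : coords | 0 <= z Y + \tr (g Y *m mx_of_coords v)]).
  by apply: closed_bigI => Y _; apply: closed_tr_ge0.
apply/seteqP; split => v /= h.
- by move=> Y hY /=; rewrite -fg psd_tr_mul.
- by apply: psd_tr_form => Y hY; rewrite fg; apply: h.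
Qed.

Lemma psd_contraction_entry (M : 'M[C]_n) x y :
    psdmx M -> psdmx (1%:M - M) ->
  -1 <= complex.Re (M x y) <= 1 /\ -1 <= complex.Im (M x y) <= 1.
Proof.
move=> M0 M1; have [/hermsymmxP Mh Mf] := M0.
have d1 z : complex.Re (M z z) <= 1.
  have := psd_diag_ge0 z M1; rewrite 2!mxE eqxx [X in _ + X]mxE lecE.
  by case: (M z z) => p q /= /andP[_]; rewrite subr_ge0.
have yx : M y x = ((M x y)^*)%C by rewrite -[in LHS]Mh !mxE.
have Q c : 0 <= M x x + c * M x y + c^* * M y x + c * c^* * M y y.
  by rewrite -form_delta2; exact: Mf.
(* With both diagonal entries at most 1, c = 1 and -1 bound the real part of [M x y], and c = i and
   -i the imaginary part. *)
have := Q 1; have := Q (-1); have := Q 'i; have := Q (- 'i).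
rewrite !lecE yx.
move: (d1 x) (d1 y); case: (M x x) (M y y) (M x y) => [r1 s1] [r2 s2] [p q] /=.
move=> h1 h2 /andP[_ +] /andP[_ +] /andP[_ +] /andP[_ +].
rewrite ?(mul0r, mul1r, mulr0, mulr1, oppr0, opprK, subr0, sub0r, add0r, addr0).
rewrite ?(mulrN, mulNr, mulN1r, mulrN1).
by move=> h3 h4 h5 h6; split; apply/andP; split; lra.
Qed.

End Compactness.

(** * Existence of an optimal test operator *)

Section FidelityMaximum.
Context {R : realType}.
Local Notation C := R[i].
Context {a b : nat}.
Implicit Types (M rho : 'M[C]_(a * b)) (eta eps : R).

(** The tests correspond to a closed subset of a compact box, on which the continuous function Re Tr
    rho M attains its maximum. *)
Lemma ppt_test_max rho eta : 0 <= eta ->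
  exists2 M, ppt_test M eta & forall M', ppt_test M' eta ->
    complex.Re (\tr (rho *m M')) <= complex.Re (\tr (rho *m M)).
Proof.
move=> eta0; pose T := {ptws 'I_(a * b) * 'I_(a * b) * bool -> R}.
pose box := [set v : T | forall t, `[(-1 : R), 1]%classic (v t)].
pose S := [set v : T | ppt_test (mx_of_coords v) eta].
have cbox : compact box.
  apply: (@tychonoff _ (fun=> R) (fun=> `[(-1 : R), 1]%classic)) => _.
  exact: segment_compact.
have cS : closed S.
  rewrite (_ : S = [set v : T | psdmx (mx_of_coords v)] `&`
    ([set v : T | psdmx (1%:M - mx_of_coords v)] `&`
     ([set v : T | psdmx (eta%:C%:M + ptransB (mx_of_coords v))] `&`
      [set v : T | psdmx (eta%:C%:M - ptransB (mx_of_coords v))]))).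
    apply: closedI; last apply: closedI; last apply: closedI.
    - apply: (closed_psd (f := id) (g := id) (z := fun=> 0)) => Y M.
      by rewrite add0r.
    - apply: (closed_psd (f := fun M => 1%:M - M) (g := -%R) (z := mxtrace)).
      by move=> Y M; rewrite mulmxBr mulmx1 mulNmx mxtraceD.
    - apply: (closed_psd (f := fun M => eta%:C%:M + ptransB M)
        (g := @ptransB R a b) (z := fun Y => eta%:C * \tr Y)) => Y M.
      by rewrite mulmxDr mxtraceD mul_mx_scalar mxtraceZ tr_ptransB_mul.
    - apply: (closed_psd (f := fun M => eta%:C%:M - ptransB M)
        (g := fun Y => - ptransB Y) (z := fun Y => eta%:C * \tr Y)) => Y M.
      rewrite mulmxBr linearB /= mul_mx_scalar mxtraceZ mulNmx -tr_ptransB_mul.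
      by congr (_ + _); rewrite [RHS]linearN.
  apply/seteqP; split => v.
    by move=> [h1 h2 h3 h4]; exact: (conj h1 (conj h2 (conj h3 h4))).
  by move=> [h1 [h2 [h3 h4]]]; exact: (And4 h1 h2 h3 h4).
have onto M : ppt_test M eta ->
    exists2 v : T, (box `&` S) v & mx_of_coords v = M.
  move=> tM; pose v (t : 'I_(a * b) * 'I_(a * b) * bool) :=
    if t.2 then complex.Im (M t.1.1 t.1.2) else complex.Re (M t.1.1 t.1.2).
  have vM : mx_of_coords v = M.
    by apply/matrixP => x y; rewrite mxE /v /=; case: (M x y).
  exists v; last exact: vM.
  split; last by rewrite /S /= vM; exact: tM.
  move=> [[x y] c]; case: tM => M0 M1 _ _.
  have [hR hI] := psd_contraction_entry x y M0 M1.
  by rewrite /v /= in_itv /=; case: c.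
(* The zero operator witnesses nonemptiness; here eta >= 0 enters. *)
have test0 : ppt_test (0 : 'M[C]_(a * b)) eta.
  have pe : psdmx (eta%:C%:M : 'M[C]_(a * b)).
    by rewrite -scalemx1; apply: psdZ (psd1 _); rewrite lecR.
  split.
  - exact: psd0.
  - by rewrite subr0; exact: psd1.
  - rewrite [ptransB _]linear0 addr0; exact: pe.
  - rewrite [ptransB _]linear0 subr0; exact: pe.
have ne : box `&` S !=set0 by have [v ? _] := onto _ test0; exists v.
have [v vS vmax] := @compact_EVT_max T R _ _ ne (compact_closedI cbox cS)
  (continuous_subspaceT (@continuous_Re_tr R _ rho)).
exists (mx_of_coords v); first by move: vS; rewrite inE => -[].
by move=> M' /onto [w wS <-]; apply: vmax; rewrite inE.
Qed.

End FidelityMaximum.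

(** * Maxima of sets of reals and of naturals *)

Section Maxima.
Context {R : realType}.

Lemma setmax_in (S : set R) : has_max S -> S (setmax S).
Proof. by move=> /(xgetPex 0) []. Qed.

Lemma setmax_ub (S : set R) x : has_max S -> S x -> x <= setmax S.
Proof. by move=> /(xgetPex 0) [_ + Sx]; apply. Qed.

Lemma has_max_nat (P : set nat) (B : R) :
  P !=set0 -> (forall k, P k -> k%:R <= B) ->
  has_max ([set k%:R | k in P] : set R).
Proof.
move=> [k0 Pk0] PB.
have exP : exists k, `[< P k >] by exists k0; apply/asboolP.
have ubP k : `[< P k >] -> (k <= Num.bound B)%N.
  move=> /asboolP /PB kB; rewrite -(@ler_nat R) (le_trans kB) //.
  by rewrite ltW // archi_boundP // (le_trans _ kB).
have [m /asboolP Pm maxm] := ex_maxnP exP ubP.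
exists m%:R; split; first by exists m.
by move=> _ [k /asboolP Pk <-]; rewrite ler_nat; apply: maxm.
Qed.

End Maxima.

(** * From fidelities to the one-shot rate *)

Section OneShotRate.
Context {R : realType}.
Local Notation C := R[i].
Context (a b : nat) (rho : 'M[C]_(a * b)) (rho_state : quantum_state rho).
Implicit Types (M : 'M[C]_(a * b)) (eps eta : R).

Lemma feasibleP eps eta M : feasible rho eps eta M <->
  ppt_test M eta /\ (1 - eps)%:C <= \tr (rho *m M).
Proof.
rewrite /feasible /loewner_le /ppt_test subr0 opprK [ptransB M + _]addrC.
split=> [[_ [h1 h2] h3 [h4 h5]]|[[h1 h2 h4 h5] h3]].
  exact: (conj (And4 h1 h2 h4 h5) h3).
exact: (And4 (proj1 h1) (conj h1 h2) h3 (conj h4 h5)).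
Qed.

Lemma ppt_test_le eta eta' M : eta <= eta' -> ppt_test M eta -> ppt_test M eta'.
Proof.
move=> le [h1 h2 h3 h4].
have E : eta'%:C%:M = (eta' - eta)%:C%:M + eta%:C%:M :> 'M[C]_(a * b).
  by rewrite -raddfD -rmorphD subrK.
have h0 : psdmx ((eta' - eta)%:C%:M : 'M[C]_(a * b)).
  by rewrite -scalemx1; apply: psdZ (psd1 _); rewrite lecR subr_ge0.
split; [exact: h1 | exact: h2 | |]; rewrite E -addrA.
  exact: (psdD h0 h3).
exact: (psdD h0 h4).
Qed.

Lemma Re_tr_state M : psdmx M ->
  (complex.Re (\tr (rho *m M)))%:C = \tr (rho *m M).
Proof.
move=> hM; apply/RRe_real/ger0_real.
exact: (psd_tr_mul (proj1 rho_state) hM).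
Qed.

Lemma tr_state_le1 M : psdmx (1%:M - M) -> \tr (rho *m M) <= 1.
Proof.
case: rho_state => h0 h1 hM; rewrite -subr_ge0 -{1}h1 -{1}[rho]mulmx1.
by rewrite -linearB /= -mulmxBr; exact: (psd_tr_mul h0 hM).
Qed.

(** The step Tr rho M <= Tr M uses rho <= 1, which follows from Tr rho = 1. *)
Lemma ppt_test_eta_ge eps eta M : ppt_test M eta ->
  (1 - eps)%:C <= \tr (rho *m M) -> 1 - eps <= eta * (a * b)%:R.
Proof.
case: rho_state => rho0 rho1 [M0 M1 _ MT] hM.
rewrite -lecR; apply: (le_trans hM).
have : 0 <= \tr ((1%:M - rho) *m M).
  by have := psd_le_tr rho0; rewrite rho1 => /psd_tr_mul; apply; exact: M0.
rewrite mulmxBl mul1mx linearB /= subr_ge0 => /le_trans; apply.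
have := psd_tr_mul (psd1 _) MT.
rewrite mul1mx linearB /= tr_ptransB mxtrace_scalar subr_ge0.
by rewrite rmorphM rmorph_nat mulr_natr.
Qed.

Lemma ppt_fidelity_test k f : (0 < k)%N -> ppt_fidelities rho k f ->
  exists2 M, ppt_test M k%:R^-1 & f%:C = \tr (rho *m M).
Proof.
move=> k0 [Pi /(ppt_operation_test k0) [M hM ME] ->].
by exists M.
Qed.

(** Psi_1 is the identity of a one-dimensional space, and the trace itself is a PPT operation. *)
Lemma ppt_fidelities1 : ppt_fidelities rho 1 1.
Proof.
have [|||Pi hPi PiE] := @trace_replace_ppt R a b 1 1%:M.
- exact: psd1.
- by rewrite ptransB1; apply: psd1.
- by rewrite mxtrace1.
exists Pi => //; rewrite PiE; case: rho_state => _ ->.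
by rewrite scale1r mul1mx tr_max_entangled.
Qed.

(* For [k = 1] the operator [M] need not come from an operation, but then the
   fidelity [1] is achieved. *)
Lemma test_ppt_fidelity k M : (0 < k)%N -> ppt_test M k%:R^-1 ->
  exists2 f, ppt_fidelities rho k f & complex.Re (\tr (rho *m M)) <= f.
Proof.
case: k => [//|[|k]] _ hM.
  exists 1; first exact: ppt_fidelities1.
  by case: hM => M0 M1 _ _; rewrite -lecR Re_tr_state // tr_state_le1.
have [//|Pi hPi PiE] := test_ppt_operation _ hM.
exists (complex.Re (\tr (rho *m M))) => //; exists Pi => //.
by rewrite PiE Re_tr_state //; case: hM.
Qed.

(** Some fidelity reaches at least the value of an optimal test, and every fidelity is the value of
    a test. *)
Lemma has_max_ppt_fidelities k : (0 < k)%N -> has_max (ppt_fidelities rho k).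
Proof.
move=> k0; have kV0 : 0 <= k%:R^-1 :> R by rewrite invr_ge0 ler0n.
have [M hM maxM] := ppt_test_max rho kV0.
have [f hf leMf] := test_ppt_fidelity k0 hM.
exists f; split => // g /(ppt_fidelity_test k0) [M' hM' gE].
by apply: le_trans leMf; rewrite -[g]/(complex.Re g%:C) gE; apply: maxM.
Qed.

Lemma fidelity_PPT_geP eps k : (0 < k)%N ->
  1 - eps <= fidelity_PPT rho k <-> exists M, feasible rho eps k%:R^-1 M.
Proof.
move=> k0; have hmax := has_max_ppt_fidelities k0; split.
  have [M hM fE] := ppt_fidelity_test k0 (setmax_in hmax).
  by move=> le; exists M; apply/feasibleP; split => //; rewrite -fE lecR.
move=> [M /feasibleP [hM]]; rewrite -Re_tr_state ?lecR; last by case: hM.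
move=> /le_trans; apply.
have [f hf /le_trans] := test_ppt_fidelity k0 hM; apply.
exact: setmax_ub hf.
Qed.

Section Rate.
Context (eps : R) (eps1 : eps < 1).

(** [P] and [Q] agree on positive integers; [Q] may also contain 0, coming from eta > 1. *)
Let P : set nat := [set k | (1 <= k)%N /\ 1 - eps <= fidelity_PPT rho k].
Let Q : set nat := [set k | exists2 eta, exists M, feasible rho eps eta M &
                                         Num.floor (1 / eta) = k :> int].

(** Positivity of eta makes 1 / eta a genuine reciprocal rather than the default 1 / 0 = 0. *)
Lemma feasible_eta_bound eta M : feasible rho eps eta M ->
  0 < eta /\ 1 / eta <= (a * b)%:R / (1 - eps).
Proof.
move=> /feasibleP [hM hrho]; have h := ppt_test_eta_ge hM hrho.
have eps' : 0 < 1 - eps by rewrite subr_gt0.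
have eta0 : 0 < eta.
  rewrite ltNge; apply/negP => eta0; have := lt_le_trans eps' h.
  by rewrite ltNge mulr_le0_ge0.
split=> //; rewrite ler_pdivlMr // mulrAC mul1r ler_pdivrMr //.
by rewrite mulrC.
Qed.

Lemma feasible_floorsE : feasible_floors rho eps = [set k%:R | k in Q].
Proof.
apply/seteqP; split => x.
  move=> [eta [M hM] <-]; have [eta0 _] := feasible_eta_bound hM.
  have : 0 <= Num.floor (1 / eta) by rewrite floor_ge0 divr_ge0 // ltW.
  case E : (Num.floor (1 / eta)) => [k|//] _.
  by exists k => //; exists eta => //; exists M.
by move=> [k [eta hM E] <-]; exists eta => //; rewrite E.
Qed.

(** The witness eta = 1/k has floor of its reciprocal exactly k. *)
Lemma dims_floors k : P k -> Q k.
Proof.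
move=> [k0 /(fidelity_PPT_geP _ k0) hM]; exists k%:R^-1 => //.
by rewrite div1r invrK -[k%:R]/(k%:~R) intrKfloor.
Qed.

(** From k <= 1/eta follows eta <= 1/k, so the same [M] passes the looser test at 1/k. *)
Lemma floors_dims k : (0 < k)%N -> Q k -> P k.
Proof.
move=> k0 [eta [M hM] E]; have [eta0 _] := feasible_eta_bound hM.
split => //; apply/fidelity_PPT_geP => //; exists M.
move: hM => /feasibleP [hM hrho]; apply/feasibleP; split; last exact: hrho.
apply: ppt_test_le hM; have := floor_le (1 / eta).
by rewrite E div1r -[k%:~R]/(k%:R) invf_pge ?posrE ?ltr0n.
Qed.

End Rate.
End OneShotRate.

Theorem proposition3 (R : realType) (a b : nat) (rho : 'M[R[i]]_(a * b))
    (eps : R) (hrho : quantum_state rho) (heps0 : 0 < eps) (heps1 : eps < 1) :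
  [/\ forall k : nat, (1 <= k)%N -> has_max (ppt_fidelities rho k),
      has_max (distillable_dims rho eps),
      has_max (feasible_floors rho eps) &
      distillable_entanglement_PPT rho eps =
        log2 (setmax (feasible_floors rho eps))].
Proof.
have hF k := @has_max_ppt_fidelities R a b rho hrho k.
set D := distillable_dims rho eps; set F := feasible_floors rho eps.
have DF : D `<=` F.
  rewrite /F feasible_floorsE // => _ [k Pk <-]; exists k => //.
  exact: dims_floors Pk.
(* Dimension 1 has fidelity at least 1 >= 1 - eps, so both sets are nonempty. *)
have D1 : D 1.
  exists 1%N => //; split => //.
  have h := setmax_ub (hF 1%N isT) (ppt_fidelities1 hrho).
  by apply: le_trans h; rewrite gerBl ltW.
have Fub x : F x -> x <= (a * b)%:R / (1 - eps).
  move=> [eta [M hM] <-]; have [_] := feasible_eta_bound hrho heps1 hM.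
  by apply: le_trans; apply: floor_le.
have hmaxD : has_max D.
  apply: (has_max_nat (B := (a * b)%:R / (1 - eps))).
    by have [k Pk _] := D1; exists k.
  by move=> k Pk; apply/Fub/DF; exists k.
have hmaxF : has_max F.
  have F1 := DF _ D1; rewrite /F feasible_floorsE // in Fub F1 *.
  apply: (has_max_nat (B := (a * b)%:R / (1 - eps))).
    by have [k Qk _] := F1; exists k.
  by move=> k Qk; apply/Fub; exists k.
split => //; rewrite /distillable_entanglement_PPT -/D; congr log2.
(* The inclusion of [D] in [F] gives one inequality between the maxima. *)
apply/eqP; rewrite eq_le (setmax_ub hmaxF) /=; last first.
  exact: (DF _ (setmax_in hmaxD)).
have := setmax_in hmaxF; move: (setmax F) => m.
(* For the other, a floor equal to 0 lies below 1, which is in [D]; a positive floor is itself in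
   [D]. *)
rewrite /F feasible_floorsE // => -[[|k] Qk <-].
  by apply: le_trans (setmax_ub hmaxD D1); apply: ler01.
by apply: setmax_ub => //; exists k.+1 => //; apply: floors_dims Qk.
Qed.
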